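(* Let $K$ be a field, $S=K[x_1,\ldots,x_n]$, and let $I$ be a monomial ideal of $S$ with minimal set of monomial generators $G(I)=\{m_1,\dots,m_r\}$. Suppose that $$\frac{\mathrm{lcm}(m_1,\dots,m_r)}{\mathrm{lcm}(m_1,\dots,\widehat{m}_i,\dots,m_r)}\notin K\quad\text{for all } 1\leq i\leq r,$$ where $\widehat{m}_i$ means that $m_i$ is omitted. Then $t_{a+b}\leq t_a+t_b$ for all integers $a,b\geq 0$ with $a+b\leq\mathrm{proj\,dim}(S/I)$, where $t_i=t_i(S/I)$ denotes the maximal shift in homological degree $i$ of the minimal graded free $S$-resolution of $S/I$.
   Context: $S=K[x_1,\ldots,x_n]$ is graded with $\deg(x_i)=1$ for all $i$. For a graded ideal $I\subset S$, $\beta_{i,j}(S/I)=\dim_K\mathrm{Tor}_i^S(S/I,K)_j$, and for $0\leq i\leq\mathrm{proj\,dim}(S/I)$ (projective dimension over $S$), $t_i=t_i(S/I):=\max\{j:\beta_{i,j}(S/I)\neq0\}$. $G(I)$ denotes the unique minimal set of monomial generators of the monomial ideal $I$. The lcm of the empty set of monomials is $1$. *)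

(* Defs.v *)
From Stdlib Require Import ClassicalEpsilon.
From HB Require Import structures.
From mathcomp Require Import all_boot all_order all_algebra.
From mathcomp Require Import generic_quotient ring_quotient.
From mathcomp Require Export mpoly.

Set Implicit Arguments.
Unset Strict Implicit.
Unset Printing Implicit Defensive.

Import GRing.Theory.
Local Open Scope ring_scope.
Local Open Scope quotient_scope.

(* [the P] is meaningful only when exactly one natural number satisfies [P];
   otherwise it is unspecified. *)
Definition the (P : nat -> Prop) : nat := epsilon (inhabits 0%N) P.

(* The library equips V / I with its additive structure only. *)
Section QuotientModule.
Variables (R : pzRingType) (V : lmodType R) (I : submodClosed V).

(* Closure under opposites comes from scaling by -1. *)
Lemma submod_zmod_closed : zmod_closed I.
Proof. by have /GRing.submod_closedB := GRing.submodClosedP I. Qed.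

Definition submod_zmodClosed : zmodClosed V :=
  let J := GRing.SubmodClosed.sort I in
  HB.pack J (GRing.isZmodClosed.Build V J submod_zmod_closed).

Local Notation Q := (Quotient.quot submod_zmodClosed).

Definition quotmod : Type := Q.

HB.instance Definition _ := GRing.Zmodule.on quotmod.

Definition quot_proj (x : V) : quotmod := \pi_Q x.

Definition quot_scale (a : R) (x : quotmod) : quotmod :=
  quot_proj (a *: repr (x : Q)).

Lemma quot_proj_zmod_morphism : zmod_morphism quot_proj.
Proof. by move=> x y; rewrite /quot_proj raddfB. Qed.

HB.instance Definition _ :=
  GRing.isZmodMorphism.Build V quotmod quot_proj quot_proj_zmod_morphism.

Lemma quot_proj_eq x y : (quot_proj x = quot_proj y) <-> (x - y \in I).
Proof.
rewrite (_ : (x - y \in I) = (x - y \in submod_zmodClosed)) //.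
by rewrite Quotient.idealrBE; split=> /eqP.
Qed.

Lemma quot_scale_proj a x : quot_scale a (quot_proj x) = quot_proj (a *: x).
Proof.
apply/quot_proj_eq; rewrite -scalerBr; apply: rpredZ.
by apply/quot_proj_eq; rewrite /quot_proj reprK.
Qed.

Lemma quot_proj_surj (x : quotmod) : exists v, quot_proj v = x.
Proof. by exists (repr (x : Q)); rewrite /quot_proj reprK. Qed.

Lemma quot_scaleA a b x : quot_scale a (quot_scale b x) = quot_scale (a * b) x.
Proof.
by have [v <-] := quot_proj_surj x; rewrite !quot_scale_proj scalerA.
Qed.

Lemma quot_scale1 : left_id 1 quot_scale.
Proof.
by move=> x; have [v <-] := quot_proj_surj x; rewrite quot_scale_proj scale1r.
Qed.

Lemma quot_scaleDr : right_distributive quot_scale +%R.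
Proof.
move=> a x y; have [v <-] := quot_proj_surj x; have [w <-] := quot_proj_surj y.
by rewrite -raddfD !quot_scale_proj scalerDr raddfD.
Qed.

Lemma quot_scaleDl x : {morph quot_scale^~ x : a b / a + b}.
Proof.
move=> a b; have [v <-] := quot_proj_surj x.
by rewrite !quot_scale_proj scalerDl raddfD.
Qed.

HB.instance Definition _ := GRing.Zmodule_isLmodule.Build R quotmod
  quot_scaleA quot_scale1 quot_scaleDr quot_scaleDl.

Lemma quot_proj_scalable : scalable quot_proj.
Proof. by move=> a x; rewrite -quot_scale_proj. Qed.

HB.instance Definition _ :=
  GRing.isScalable.Build R V quotmod *:%R quot_proj quot_proj_scalable.

End QuotientModule.

Section ProjectiveDimension.
Variable R : nzRingType.

Definition projective (P : lmodType R) : Prop :=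
  forall (A B : lmodType R) (g : {linear A -> B}) (f : {linear P -> B}),
    (forall b, exists a, g a = b) ->
    exists h : {linear P -> A}, forall x, g (h x) = f x.

(* The augmented complex ... -> P 2 -> P 1 -> P 0 -> M -> 0 is exact. *)
Definition is_resolution (M : lmodType R) (P : nat -> lmodType R)
    (d : forall i, {linear P i.+1 -> P i}) (aug : {linear P 0%N -> M}) : Prop :=
  [/\ forall y, exists x, aug x = y,
      forall x, aug x = 0 <-> exists y, d 0%N y = x
    & forall i x, d i x = 0 <-> exists y, d i.+1 y = x].

Definition proj_dim_le (M : lmodType R) (p : nat) : Prop :=
  exists (P : nat -> lmodType R) (d : forall i, {linear P i.+1 -> P i})
         (aug : {linear P 0%N -> M}),
    [/\ is_resolution d aug,
        forall i, projective (P i)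
      & forall i, (p < i)%N -> forall x : P i, x = 0].

(* Unspecified for modules of infinite projective dimension; these do not occur
   among finitely generated modules over a polynomial ring over a field. *)
Definition proj_dim (M : lmodType R) : nat :=
  the (fun p => proj_dim_le M p /\ forall q, proj_dim_le M q -> (p <= q)%N).

End ProjectiveDimension.

(* An ideal of S = {mpoly K[n]} is a submodule of S^o. *)
Section GradedBetti.
Variables (K : fieldType) (n : nat) (I : submodClosed {mpoly K[n]}^o).
Local Notation S := {mpoly K[n]}.

(* F_i = \bigoplus_k S(- gfc_shift i k), realised as row vectors, so that the
   differential F_(i+1) -> F_i is right multiplication by gfc_diff i.
   Nonnegative shifts suffice because S / I lives in nonnegative degrees. *)
Record graded_free_complex := GradedFreeComplex {
  gfc_rank : nat -> nat;
  gfc_shift : forall i, 'I_(gfc_rank i) -> nat;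
  gfc_diff : forall i, 'M[S]_(gfc_rank i.+1, gfc_rank i);
  gfc_aug : {linear 'rV[S]_(gfc_rank 0%N) -> quotmod I} }.

Definition is_graded_free_resolution (F : graded_free_complex) : Prop :=
  [/\ forall i k l,
        gfc_diff F i k l = 0 \/
        exists2 e, (e + gfc_shift l = gfc_shift k)%N
                 & gfc_diff F i k l \is e.-homog,
      forall k, exists2 f : S, f \is (gfc_shift k).-homog
                             & gfc_aug F (delta_mx 0 k) = quot_proj I f
    & @is_resolution S (quotmod I) (fun i => 'rV[S]_(gfc_rank F i))
        (fun i => mulmxr (gfc_diff F i)) (gfc_aug F)].

Section Tor.
Variable F : graded_free_complex.

(* F (x)_S K, where K = S / (x_1, ..., x_n): the matrix entries are replaced by
   their constant terms. *)
Definition tor_diff i : 'M[K]_(gfc_rank F i.+1, gfc_rank F i) :=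
  map_mx (mcoeff 0%MM) (gfc_diff F i).

Definition tor_cycles i : 'M[K]_(gfc_rank F i) :=
  match i with
  | 0%N => 1%:M
  | i'.+1 => kermx (tor_diff i')
  end.

(* The degree j component of F_i (x)_S K. *)
Definition tor_degree i (j : nat) : 'M[K]_(gfc_rank F i) :=
  diag_mx (\row_k (gfc_shift k == j)%:R).

Definition tor_dim i j : nat :=
  (\rank (tor_cycles i :&: tor_degree i j)
   - \rank (tor_diff i :&: tor_degree i j))%N.

End Tor.

(* dim_K Tor_i^S(S / I, K)_j, computed from any graded free resolution
   of S / I by free modules of finite rank. *)
Definition betti (i j : nat) : nat :=
  the (fun b => exists2 F, is_graded_free_resolution F & tor_dim F i j = b).

(* Unspecified when Tor_i^S(S / I, K) = 0. *)
Definition max_shift (i : nat) : nat :=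
  the (fun t => betti i t <> 0%N /\
                forall j, betti i j <> 0%N -> (j <= t)%N).

End GradedBetti.

Section MonomialIdeals.
Variables (K : fieldType) (n r : nat) (I : submodClosed {mpoly K[n]}^o).
Variable m : 'I_r -> 'X_{1..n}.

Definition generated_by (A : {set 'I_r}) : Prop :=
  forall f : {mpoly K[n]},
    f \in I <-> exists c : 'I_r -> {mpoly K[n]},
                  f = \sum_(i in A) c i * 'X_[m i].

(* Minimality also rules out repetitions m i = m j with i != j. *)
Definition minimal_monomial_generators : Prop :=
  generated_by [set: 'I_r] /\
  forall A : {set 'I_r}, A \proper [set: 'I_r] -> ~ generated_by A.

End MonomialIdeals.

(* Monomials are identified with their exponent vectors, so the lcm of the empty
   family, the monomial 1, is 0%MM. *)
Definition lcm_family (n r : nat) (A : {set 'I_r}) (m : 'I_r -> 'X_{1..n}) :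
    'X_{1..n} :=
  \big[@mlcm n/0%MM]_(i in A) m i.

(* Main.v *)
Require Import Defs.
From HB Require Import structures.
From mathcomp Require Import all_boot all_order all_algebra.

(** The hypothesis gives each generator [m i] a variable whose exponent in [m i]
    exceeds its exponent in every other generator, so adjoining [i] to a set [B]
    of generators strictly increases the lcm.  Hence no entry of the
    differential of the Taylor complex has a constant term: the Taylor resolution is minimal,
    [Tor_i] has a basis indexed by the [i]-subsets [A], in degree
    [mdeg (lcm A)], and [max_shift I i] is the largest such degree.  The
    projective dimension is at most [r], and [lcm (B :|: C)] divides
    [lcm B * lcm C].

    The Taylor complex embeds into the simplicial chain complex of the full
    simplex by multiplying the coefficient of the face [A] with [lcm A]; in each
    multidegree [u] the image is the chain complex of the simplex on the
    generators dividing [u], which is contractible unless it is empty. *)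

Set Implicit Arguments.
Unset Strict Implicit.
Unset Printing Implicit Defensive.

Import GRing.Theory.
Local Open Scope ring_scope.

(** * Lcms of families of monomials *)

Section LcmFamily.
Variables (n r : nat) (m : 'I_r -> 'X_{1..n}).
Implicit Types (A B : {set 'I_r}) (u : 'X_{1..n}).
Local Notation lc A := (lcm_family A m).

Lemma lcm_familyE A v : lc A v = \max_(i in A) m i v.
Proof.
rewrite /lcm_family; elim/big_rec2: _ => [|i x y _ <-]; first by rewrite mnm0E.
by rewrite /mlcm mnmE.
Qed.

Lemma lcm_familyP A u :
  reflect (forall i, i \in A -> (m i <= u)%MM) (lc A <= u)%MM.
Proof.
apply: (iffP idP) => [/mnm_lepP le_u i iA | le_u].
  apply/mnm_lepP => v; apply: leq_trans (le_u v).
  by rewrite lcm_familyE (leq_bigmax_cond (F := fun i => m i v)).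
apply/mnm_lepP => v; rewrite lcm_familyE; apply/bigmax_leqP => i iA.
exact/mnm_lepP/le_u.
Qed.

Lemma lem_lcm_family i A : i \in A -> (m i <= lc A)%MM.
Proof. by move: i; apply/lcm_familyP/lepm_refl. Qed.

Lemma lcm_familyS A B : A \subset B -> (lc A <= lc B)%MM.
Proof.
by move=> /subsetP sAB; apply/lcm_familyP => i /sAB; apply: lem_lcm_family.
Qed.

Lemma lcm_family0 : lc set0 = 0%MM.
Proof. by rewrite /lcm_family big_set0. Qed.

Lemma lcm_family1 i : lc [set i] = m i.
Proof. by apply/mnmP => v; rewrite lcm_familyE big_set1. Qed.

Lemma mdeg_le (u1 u2 : 'X_{1..n}) : (u1 <= u2)%MM -> (mdeg u1 <= mdeg u2)%N.
Proof. by move=> /submK <-; rewrite mdegD leq_addl. Qed.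

Lemma mdeg_lcm_familyU A B :
  (mdeg (lc (A :|: B)) <= mdeg (lc A) + mdeg (lc B))%N.
Proof.
rewrite -mdegD; apply/mdeg_le/lcm_familyP => i; rewrite inE.
case/orP=> /lem_lcm_family/lepm_trans; apply; [exact: lem_addr | exact: lem_addl].
Qed.

End LcmFamily.

(** * Coefficients of polynomials and divisibility by monomials *)

Section MonomialParts.
Variables (K : fieldType) (n : nat).
Local Notation S := {mpoly K[n]}.
Implicit Types (p : S) (u : 'X_{1..n}).

Definition mfilter (q : pred 'X_{1..n}) p : S :=
  \sum_(u <- msupp p | q u) p@_u *: 'X_[u].

Lemma mcoeff_filter q p u : (mfilter q p)@_u = if q u then p@_u else 0.
Proof.
rewrite /mfilter raddf_sum /=.
under eq_bigr => v _ do rewrite mcoeffZ mcoeffX.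
have [up | /memN_msupp_eq0 up] := boolP (u \in msupp p); last first.
  rewrite up if_same big1 // => v _; case: eqP => [->|]; last by rewrite mulr0.
  by rewrite up mul0r.
rewrite big_mkcond (bigD1_seq u) ?msupp_uniq //= eqxx mulr1 big1 ?addr0 //.
by move=> v /negPf ->; rewrite mulr0 if_same.
Qed.

Lemma mpoly_divX u p :
  (forall v, p@_v != 0 -> (u <= v)%MM) -> exists p', p = p' * 'X_[u].
Proof.
move=> le_u; exists (\sum_(v <- msupp p) p@_v *: 'X_[v - u]).
rewrite {1}[p]mpolyE mulr_suml; apply: eq_big_seq => v.
by rewrite mcoeff_msupp => /le_u/submK uv; rewrite -scalerAl -mpolyXD uv.
Qed.

Lemma mcoeff_mulX u p v : (p * 'X_[u])@_v != 0 -> (u <= v)%MM.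
Proof.
rewrite -mcoeff_msupp (perm_mem (msuppMX p u)) => /mapP[w _ ->].
exact: lem_addr.
Qed.

Lemma mulX_inj u : injective (fun p => p * 'X_[u]).
Proof.
move=> p q pq; apply/mpolyP => v.
by rewrite -(mcoeffMX p u) -(mcoeffMX q u) pq.
Qed.

End MonomialParts.

(** * The chain complex of the full simplex *)

Lemma sum_antisym (V : zmodType) (k : nat) (g : 'I_k -> 'I_k -> V) :
  (forall i, g i i = 0) -> (forall i j, g i j = - g j i) ->
  \sum_i \sum_j g i j = 0.
Proof.
move=> g0 gN.
have split_g i : \sum_j g i j =
    \sum_(j : 'I_k | (j < i)%N) g i j + \sum_(j : 'I_k | (i < j)%N) g i j.
  rewrite (bigID (fun j : 'I_k => (j < i)%N)) /=; congr (_ + _).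
  rewrite (bigD1 i) ?ltnn //= g0 add0r; apply: eq_bigl => j.
  by rewrite -leqNgt ltn_neqAle andbC eq_sym.
under eq_bigr => i _ do rewrite split_g.
(* The diagonal vanishes by [g0], which antisymmetry alone would not give in the presence of
   2-torsion. Exchanging the order of summation in one half pairs each [g i j] with [g j i]. *)
rewrite big_split /= addrC.
rewrite (exchange_big_dep predT) //= -big_split big1 //= => j _.
by rewrite -big_split big1 //= => i _; rewrite gN addNr.
Qed.

Section SimplicialBoundary.
Variables (K : fieldType) (n r : nat).
Local Notation S := {mpoly K[n]}.
Implicit Types (A B C : {set 'I_r}) (f : {set 'I_r} -> S).

Definition bd_sign (i : 'I_r) B : K := (-1) ^+ #|[set j in B | (j < i)%N]|.

(** The coefficient at the face [B] of the boundary of the chain with coefficients [f]. The empty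
    set counts as a face, so the complex is augmented. *)
Definition simplex_bd f B : S := \sum_(i | i \notin B) bd_sign i B *: f (i |: B).

Lemma bd_signK i B : bd_sign i B * bd_sign i B = 1.
Proof. by rewrite /bd_sign -expr2 sqrr_sign. Qed.

Lemma bd_signU1 i j B :
  j \notin B -> bd_sign i (j |: B) = (-1) ^+ (j < i)%N * bd_sign i B.
Proof.
move=> jB; rewrite /bd_sign -exprD; congr (_ ^+ _).
have [ji | ij] := boolP (j < i)%N.
  rewrite (_ : [set l in j |: B | (l < i)%N] = j |: [set l in B | (l < i)%N]).
    by rewrite cardsU1 !inE (negPf jB).
  by apply/setP => l; rewrite !inE; case: eqP => // ->; rewrite ji.
rewrite add0n; apply: eq_card => l; rewrite !inE.
by case: eqP => // ->; rewrite (negPf ij) !andbF.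
Qed.

Lemma bd_sign_swap i j B : i != j -> i \notin B -> j \notin B ->
  bd_sign i (j |: B) * bd_sign j B = - (bd_sign j (i |: B) * bd_sign i B).
Proof.
move=> ij iB jB; rewrite !bd_signU1 // -!mulrA [bd_sign j B * _]mulrC -mulNr.
by congr (_ * _); have [//|ji|ij'] := ltngtP i j; rewrite ?opprK //;
  case/negP: ij; apply/eqP/val_inj.
Qed.

Lemma simplex_bdK f C : simplex_bd (simplex_bd f) C = 0.
Proof.
(* Extended by zero to all pairs, the terms of the double sum are antisymmetric by
   [bd_sign_swap]. *)
pose g j i := if [&& j \notin C, i \notin C & i != j]
  then (bd_sign j C * bd_sign i (j |: C)) *: f (i |: (j |: C)) else 0.
transitivity (\sum_j \sum_i g j i); last first.
  apply: sum_antisym => [i | i j]; first by rewrite /g eqxx !andbF.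
  rewrite /g eq_sym andbCA; case: ifP; last by rewrite oppr0.
  case/and3P=> jC iC ij; rewrite setUCA -scaleNr; congr (_ *: _).
  by rewrite mulrC bd_sign_swap 1?eq_sym // mulrC.
rewrite /simplex_bd big_mkcond; apply: eq_bigr => j _.
case: ifP => [jC | /negbT jC]; last first.
  by rewrite big1 // => i _; rewrite /g (negPf jC).
rewrite scaler_sumr big_mkcond; apply: eq_bigr => i _.
by rewrite /g jC !inE negb_or scalerA andbC.
Qed.

End SimplicialBoundary.

(** * The Taylor differential and its exactness *)

Section Taylor.
Variables (K : fieldType) (n r : nat) (m : 'I_r -> 'X_{1..n}).
Local Notation S := {mpoly K[n]}.
Local Notation lc A := (lcm_family A m).
Local Notation sgn := (@bd_sign K r).
Implicit Types (A B C : {set 'I_r}) (f F : {set 'I_r} -> S).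

(** The support condition describes the image of the Taylor complex; coning over a vertex whose
    generator divides [u] preserves it. The face [set0] is excluded because in a multidegree that no
    generator divides it is the only face left, and it bounds nothing. *)
Lemma simplex_bd_exact F :
    (forall C, simplex_bd F C = 0) ->
    (forall A u, (F A)@_u != 0 -> (lc A <= u)%MM) ->
  exists2 G : {set 'I_r} -> S, (forall A u, (G A)@_u != 0 -> (lc A <= u)%MM)
    & forall B, B != set0 -> simplex_bd G B = F B.
Proof.
move=> Fcycle Fsupp.
(* Contract the simplex in multidegree [u] onto one of its vertices. *)
pose vertex u := [pick i | (m i <= u)%MM].
pose part i := @mfilter K n (fun u => vertex u == Some i).
pose G A := \sum_(i in A) sgn i (A :\ i) *: part i (F (A :\ i)).
have GE A u : (G A)@_u = \sum_(i in A) if vertex u == Some i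
    then sgn i (A :\ i) * (F (A :\ i))@_u else 0.
  rewrite raddf_sum; apply: eq_bigr => i _ /=.
  by rewrite mcoeffZ mcoeff_filter; case: ifP; rewrite ?mulr0.
have G0 A u : (if vertex u is Some i then i \notin A else true) ->
    (G A)@_u = 0.
  move=> uA; rewrite GE big1 // => i iA; case: eqP => // ui.
  by move: uA; rewrite ui iA.
have GS A u i : vertex u = Some i -> i \in A ->
    (G A)@_u = sgn i (A :\ i) * (F (A :\ i))@_u.
  move=> ui iA; rewrite GE (bigD1 i) //= ui eqxx big1 ?addr0 // => j.
  by case/andP=> _ ji; rewrite (_ : _ == _ = false) //; apply/eqP => -[/esym/eqP];
    rewrite (negPf ji).
exists G => [A u | B Bn0].
  case ui: (vertex u) (G0 A u) => [i|] // GA0; last by rewrite GA0 ?eqxx.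
  have [iA | iA] := boolP (i \in A); last by rewrite GA0 ?eqxx.
  rewrite (GS _ _ _ ui iA) => nz.
  have /Fsupp/lcm_familyP leA: (F (A :\ i))@_u != 0.
    by apply: contraNneq nz => ->; rewrite mulr0.
  apply/lcm_familyP => j jA; have [-> | ji] := eqVneq j i.
    by move: ui; rewrite /vertex; case: pickP => // ? le [<-].
  by apply: leA; rewrite !inE ji.
apply/mpolyP => u; rewrite /simplex_bd raddf_sum /=.
under eq_bigr => i _ do rewrite mcoeffZ.
case ui: (vertex u) => [i|]; last first.
  rewrite big1 => [|j _]; last by rewrite G0 ?ui // mulr0.
  apply/esym/eqP; apply: contraTT Bn0 => /Fsupp/lcm_familyP leB.
  rewrite negbK; apply/set0Pn => -[j /leB ju]; move: ui; rewrite /vertex.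
  by case: pickP => // /(_ j); rewrite ju.
(* If [B] misses the cone vertex [i], only the summand of [i] survives. Otherwise the cycle
   condition at [B :\ i] expresses [F B] through the faces that replace [i] by another vertex, and
   these match the summands of the boundary of [G]. *)
have [iB | iB] := boolP (i \in B); last first.
  rewrite (bigD1 i) //= big1 ?addr0 => [|j /andP[_ ji]]; last first.
    by rewrite G0 ?mulr0 // ui !inE negb_or iB eq_sym ji.
  by rewrite (GS _ _ _ ui) ?setU11 // setU1K // mulrA bd_signK mul1r.
have [iB' defB] : i \notin B :\ i /\ i |: (B :\ i) = B.
  by rewrite setD11 setD1K.
move: (B :\ i) iB' defB => B' iB' defB.
have := congr1 (mcoeff u) (Fcycle B'); rewrite /simplex_bd raddf_sum /= mcoeff0.
under eq_bigr => j _ do rewrite mcoeffZ.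
rewrite (bigD1 i) //= defB => /eqP; rewrite addr_eq0 => /eqP FB.
rewrite -[RHS]mul1r -(bd_signK K i B') -mulrA FB mulrN mulr_sumr -sumrN.
apply: eq_big => [j | j].
  by rewrite -defB !inE negb_or andbC.
rewrite -defB !inE negb_or => /andP[ji jB'].
have iA : i \in j |: (i |: B') by rewrite !inE eqxx orbT.
rewrite (GS _ _ _ ui iA) setUCA setU1K; last by rewrite !inE negb_or eq_sym ji.
rewrite !mulrA -mulNr; congr (_ * _).
rewrite -[sgn j (i |: B')]mulr1 -(bd_signK K i B') mulrA bd_sign_swap // !mulNr.
by rewrite [in LHS]mulrC !mulrA bd_signK mul1r [in RHS]mulrC.
Qed.

(** The matrix entry of the Taylor differential from [A] to [B]. At most one summand occurs, namely
    when [A] is [B] with one vertex added. *)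
Definition taylor_coef A B : S :=
  \sum_(i | (i \notin B) && (i |: B == A)) sgn i B *: 'X_[lc A - lc B].

Definition taylor_bd f B : S :=
  \sum_(i | i \notin B) sgn i B *: (f (i |: B) * 'X_[lc (i |: B) - lc B]).

Lemma taylor_bd_simplex f B :
  taylor_bd f B * 'X_[lc B] = simplex_bd (fun A => f A * 'X_[lc A]) B.
Proof.
rewrite /taylor_bd mulr_suml; apply: eq_bigr => i _.
by rewrite -scalerAl -mulrA -mpolyXD submK // lcm_familyS // subsetUr.
Qed.

(** Inherited from [simplex_bdK], since multiplication by [lc C] is injective. *)
Lemma taylor_bdK f C : taylor_bd (taylor_bd f) C = 0.
Proof.
apply: (@mulX_inj _ _ (lc C)); rewrite mul0r taylor_bd_simplex.
rewrite -[RHS](simplex_bdK (fun A => f A * 'X_[lc A]) C).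
by apply: eq_bigr => i _; rewrite taylor_bd_simplex.
Qed.

Lemma taylor_bd_exact f : (forall C, taylor_bd f C = 0) ->
  exists g, forall B, B != set0 -> taylor_bd g B = f B.
Proof.
move=> fcycle; pose F A := f A * 'X_[lc A].
have [||G Gsupp GF] := @simplex_bd_exact F.
- by move=> C; rewrite -taylor_bd_simplex fcycle mul0r.
- by move=> A u /mcoeff_mulX.
(* The support of [G A] makes it divisible by [lc A], which pulls [G] back to the Taylor complex. *)
have /fin_all_exists [g Gg] A : exists p, G A = p * 'X_[lc A].
  exact: mpoly_divX (Gsupp A).
exists g => B /GF GB; apply: (@mulX_inj _ _ (lc B)).
by rewrite taylor_bd_simplex -[RHS]GB; apply: eq_bigr => i _; rewrite Gg.
Qed.

End Taylor.

(** * Homogeneous matrices over the polynomial ring *)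

Section HomogeneousMatrices.
Variables (K : fieldType) (n : nat).
Local Notation S := {mpoly K[n]}.

(** Multiplication by [q] raises degrees by [e], so only one component of [p] contributes. The case
    distinction guards the truncated subtraction. *)
Lemma pihomogM (d e : nat) (p q : S) : q \is e.-homog ->
  pihomog mdeg d (p * q)
    = if (e <= d)%N then pihomog mdeg (d - e) p * q else 0.
Proof.
move=> hq; have pE := pihomog_partitionE (leqnn (msize p)).
rewrite [in LHS]pE mulr_suml raddf_sum /=.
case: leqP => [ed | de].
  rewrite [in RHS]pE raddf_sum mulr_suml; apply: eq_bigr => i _ /=.
  have hi := pihomogP mdeg i p; have hiq := dhomogM hi hq.
  have [def_i | ni] := eqVneq (i : nat) (d - e)%N.
    by rewrite def_i subnK // in hi hiq *; rewrite (pihomog_dE hiq) (pihomog_dE hi).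
  rewrite (pihomog_ne0 ni hi) mul0r (pihomog_ne0 _ hiq) //.
  by apply: contraNneq ni => <-; rewrite addnK.
apply: big1 => i _; have hi := pihomogP mdeg i p; have hiq := dhomogM hi hq.
rewrite (pihomog_ne0 _ hiq) //.
by apply: contraTneq de => <-; rewrite -leqNgt leq_addl.
Qed.

Definition mx_homog p q (s : 'I_p -> nat) (t : 'I_q -> nat) (A : 'M[S]_(p, q)) :=
  forall k l, A k l = 0 \/ exists2 e, (e + t l = s k)%N & A k l \is e.-homog.

(** The degree 0 component of the map given by [A] between graded free modules with shifts [s] and
    [t]. *)
Definition mx_hpart p q (s : 'I_p -> nat) (t : 'I_q -> nat) (A : 'M[S]_(p, q)) :=
  \matrix_(k, l) if (t l <= s k)%N then pihomog mdeg (s k - t l) (A k l) else 0.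

Lemma mx_hpart_homog p q s t (A : 'M_(p, q)) : mx_homog s t (mx_hpart s t A).
Proof.
move=> k l; rewrite mxE; case: leqP => [le_ts|]; last by left.
by right; exists (s k - t l)%N; rewrite ?subnK ?pihomogP.
Qed.

Lemma mx_hpart_id p q s t (A : 'M_(p, q)) : mx_homog s t A -> mx_hpart s t A = A.
Proof.
move=> hA; apply/matrixP=> k l; rewrite mxE.
case: (hA k l) => [-> | [e <- he]]; first by rewrite raddf0 if_same.
by rewrite leq_addl addnK pihomog_dE.
Qed.

(** This turns an arbitrary lift through a homogeneous matrix into a homogeneous lift. *)
Lemma mx_hpart_mul p q l s t u (A : 'M_(p, q)) (D : 'M_(q, l)) :
  mx_homog t u D -> mx_hpart s u (A *m D) = mx_hpart s t A *m D.
Proof.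
move=> hD; apply/matrixP=> i k; rewrite !mxE.
under [in RHS]eq_bigr => j _ do rewrite mxE.
transitivity (\sum_j if (u k <= s i)%N
    then pihomog mdeg (s i - u k) (A i j * D j k) else 0).
  by case: leqP => _; [rewrite raddf_sum | rewrite big1].
apply: eq_bigr => j _; case: (hD j k) => [-> | [e def_t he]].
  by rewrite !mulr0 raddf0 if_same.
rewrite (pihomogM _ _ he) -def_t [(e + _)%N]addnC -subnDA.
have [le_us | lt_su] := leqP (u k) (s i).
  rewrite leq_subRL //; case: leqP => // _; by rewrite mul0r.
by rewrite leqNgt (leq_trans lt_su) ?leq_addr // mul0r.
Qed.

Lemma mx_homog_mcoeff0 p q s t (A : 'M_(p, q)) k l :
  mx_homog s t A -> s k != t l -> (A k l)@_0 = 0.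
Proof.
move=> hA ne; case: (hA k l) => [-> | [e def_s he]]; first by rewrite mcoeff0.
apply: (dhomog_nemf_coeff he); rewrite /= mdeg0.
by apply: contraNneq ne => e0; rewrite -def_s -e0.
Qed.

End HomogeneousMatrices.

(** * Lifting of matrices and ranks of subquotients *)

Lemma mx_lift (R : comNzRingType) p q l (A : 'M[R]_(p, l)) (D : 'M_(q, l)) :
  (forall k, exists y, y *m D = row k A) -> exists X, X *m D = A.
Proof.
move=> /fin_all_exists[y yD]; exists (\matrix_k y k).
by apply/row_matrixP => k; rewrite row_mul rowK yD.
Qed.

Lemma mulmx_eq (R : comNzRingType) p q (A B : 'M[R]_(p, q)) :
  (forall x : 'rV_p, x *m A = x *m B) -> A = B.
Proof. by move=> AB; apply/row_matrixP => k; rewrite !rowE AB. Qed.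

(* [P] induces an injection of [Z / B] into [Z' / B'], with left inverse
   induced by [Q]. *)
Lemma rank_quotient_le (K : fieldType) p q a b c d
    (Z : 'M[K]_(a, p)) (B : 'M_(b, p)) (Z' : 'M_(c, q)) (B' : 'M_(d, q))
    (P : 'M_(p, q)) (Q : 'M_(q, p)) :
  (Z *m P <= Z')%MS -> (B' <= Z')%MS -> (B' *m Q <= B)%MS ->
  (Z *m (P *m Q - 1%:M) <= B)%MS ->
  (\rank Z - \rank B <= \rank Z' - \rank B')%N.
Proof.
move=> ZP BZ BQ ZPQ; set C := (Z :\: B)%MS.
have CZ : (C <= Z)%MS by apply: diffmxSl.
(* Here [C] is a complement of [Z :&: B] in [Z]. Writing [u] as [u *m P *m Q - u *m (P *m Q - 1%:M)]
   places it in [B], which meets [C] trivially. *)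
have C0 l (u : 'M_(l, p)) : (u <= C)%MS -> (u *m P <= B')%MS -> u = 0.
  move=> uC uP; apply/eqP; rewrite -submx0 -(capmx_diff Z B) sub_capmx uC /=.
  have -> : u = u *m P *m Q - u *m (P *m Q - 1%:M).
    by rewrite mulmxBr mulmx1 mulmxA subKr.
  apply: addmx_sub; first exact: submx_trans (submxMr _ uP) BQ.
  rewrite eqmx_opp; apply: submx_trans ZPQ; apply: submxMr.
  exact: submx_trans uC CZ.
have rankCP : \rank (C *m P) = \rank C.
  apply/mxrank_injP/eqP; apply: C0; first exact: capmxSl.
  by have /sub_kermxP -> := capmxSr C (kermx P); apply: sub0mx.
have capCP : (C *m P :&: B')%MS = 0.
  have /submxP[D defD] := capmxSl (C *m P) B'.
  rewrite defD mulmxA (C0 _ (D *m C)) ?mul0mx ?submxMl //.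
  by rewrite -mulmxA -defD capmxSr.
have : (\rank C + \rank B' <= \rank Z')%N.
  rewrite -rankCP -mxrank_disjoint_sum // mxrankS // addsmx_sub BZ andbT.
  exact: submx_trans (submxMr _ CZ) ZP.
move=> leC; rewrite leq_subLR; apply: leq_trans (_ : \rank B + \rank C <= _)%N.
  by rewrite -(mxrank_cap_compl Z B) leq_add2r mxrankS ?capmxSr.
by rewrite leq_add2l leq_subRL ?mxrankS // addnC.
Qed.

(** * Comparison of graded free resolutions and independence of Tor *)

Section Comparison.
Variables (K : fieldType) (n : nat) (I : submodClosed {mpoly K[n]}^o).
Local Notation S := {mpoly K[n]}.
Hypothesis I_homog : forall d (f : S), f \in I -> pihomog mdeg d f \in I.
Local Notation shift F i := (@gfc_shift K n I F i).
Implicit Types F G H : graded_free_complex I.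

(** [X] is the component in degree [i] of a chain map over the identity of [S / I], defined up to
    degree [i]. Quantifying over the lower components avoids a dependent family of matrices. *)
Fixpoint chain_map F G i : 'M[S]_(gfc_rank F i, gfc_rank G i) -> Prop :=
  match i with
  | 0%N => fun X => forall x, gfc_aug G (x *m X) = gfc_aug F x
  | i'.+1 => fun X => exists2 Y : 'M_(gfc_rank F i', gfc_rank G i'),
      chain_map Y & X *m gfc_diff G i' = gfc_diff F i' *m Y
  end.

Lemma chain_map_comp F G H i X Y :
  @chain_map F G i X -> @chain_map G H i Y -> @chain_map F H i (X *m Y).
Proof.
elim: i X Y => [|i IHi] X Y /=; first by move=> hX hY x; rewrite mulmxA hY hX.
move=> [X' hX' XE] [Y' hY' YE]; exists (X' *m Y'); first exact: IHi.
by rewrite -mulmxA YE !mulmxA XE.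
Qed.

Section Resolution.
Variable F : graded_free_complex I.
Hypothesis resF : is_graded_free_resolution F.
Local Notation d := (gfc_diff F).

Lemma gfr_homog i : mx_homog (shift F i.+1) (shift F i) (d i).
Proof. by case: resF => hd _ _ k l; apply: hd. Qed.

Lemma gfr_aug_diff x : gfc_aug F (x *m d 0) = 0.
Proof. by case: resF => _ _ [_ h _]; apply/h; exists x. Qed.

Lemma gfr_diff_diff i : d i.+1 *m d i = 0.
Proof.
apply: mulmx_eq => x; rewrite mulmx0 mulmxA.
by case: resF => _ _ [_ _ h]; apply: (proj2 (h i (x *m d i.+1))); exists x.
Qed.

Lemma gfr_lift0 p (A : 'M_(p, gfc_rank F 0)) :
  (forall k, gfc_aug F (row k A) = 0) -> exists X, X *m d 0 = A.
Proof.
by move=> A0; apply: mx_lift => k; case: resF => _ _ [_ h _]; apply/h.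
Qed.

Lemma gfr_lift i p (A : 'M_(p, gfc_rank F i.+1)) :
  A *m d i = 0 -> exists X, X *m d i.+1 = A.
Proof.
move=> A0; apply: mx_lift => k; case: resF => _ _ [_ _ h].
by apply/(h i (row k A)); rewrite /= -row_mul A0 row0.
Qed.

End Resolution.

Lemma gfc_aug_coord F (v : 'rV_(gfc_rank F 0)) (g : 'I_(gfc_rank F 0) -> S) :
  (forall k, gfc_aug F (delta_mx 0 k) = quot_proj I (g k)) ->
  gfc_aug F v = quot_proj I (\sum_k v 0 k * g k).
Proof.
move=> hg; rewrite {1}[v]row_sum_delta !linear_sum; apply: eq_bigr => k _.
by rewrite linearZ hg -linearZ.
Qed.

Section ChainMaps.
Variables F G : graded_free_complex I.
Hypotheses (resF : is_graded_free_resolution F) (resG : is_graded_free_resolution G).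

Lemma chain_map_start : exists2 X, @chain_map F G 0 X
  & mx_homog (shift F 0) (shift G 0) X.
Proof.
have [_ augF _] := resF; have [_ augG [surjG _ _]] := resG.
have /fin_all_exists2[f f_homog fE] k := augF k.
have /fin_all_exists2[g g_homog gE] k := augG k.
have /fin_all_exists[v vE] k : exists v, gfc_aug G v = quot_proj I (f k).
  by have [v <-] := surjG (quot_proj I (f k)); exists v.
(* The degree 0 part of the lift is still compatible with the augmentations, because [I] contains
   the homogeneous components of its elements. *)
set X := mx_hpart (shift F 0) (shift G 0) (\matrix_k v k).
exists X; last exact: mx_hpart_homog.
have XE k : gfc_aug G (row k X) = gfc_aug F (delta_mx 0 k).
  rewrite fE (gfc_aug_coord _ gE); apply/quot_proj_eq.
  move: (vE k); rewrite (gfc_aug_coord _ gE) => /quot_proj_eq.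
  move/(I_homog (gfc_shift k)); rewrite raddfB raddf_sum /=.
  rewrite [pihomog _ _ (f k)]pihomog_dE //; congr (_ - _ \in I).
  apply: eq_bigr => l _; rewrite !mxE (pihomogM _ _ (g_homog l)).
  by case: ifP; rewrite ?mul0r.
move=> x /=; rewrite [x in RHS]row_sum_delta mulmx_sum_row !linear_sum.
by apply: eq_bigr => k _; rewrite !linearZ /= XE.
Qed.

Lemma chain_map_step i Y : @chain_map F G i Y ->
    mx_homog (shift F i) (shift G i) Y ->
  exists2 X, X *m gfc_diff G i = gfc_diff F i *m Y
    & mx_homog (shift F i.+1) (shift G i.+1) X.
Proof.
move=> hY homY.
(* Any lift suffices: the differentials and [Y] are homogeneous, so its degree 0 part is again a
   lift. *)
suff [X XE] : exists X, X *m gfc_diff G i = gfc_diff F i *m Y.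
  exists (mx_hpart (shift F i.+1) (shift G i.+1) X).
    rewrite -(mx_hpart_mul _ _ (@gfr_homog _ resG i)) XE.
    rewrite (mx_hpart_mul _ _ homY) mx_hpart_id //; exact: (@gfr_homog _ resF i).
  exact: mx_hpart_homog.
case: i => [|i] in Y hY homY *.
  apply: gfr_lift0 resG _ _ _ => k.
  by rewrite row_mul hY rowE gfr_aug_diff.
case: hY => Y' _ YE; apply: gfr_lift resG _ _ _ _.
by rewrite -mulmxA YE mulmxA gfr_diff_diff // mul0mx.
Qed.

Lemma chain_map_exists i : exists2 X, @chain_map F G i X
  & mx_homog (shift F i) (shift G i) X.
Proof.
elim: i => [|i [Y hY homY]]; first exact: chain_map_start.
by have [X XE homX] := chain_map_step hY homY; exists X => //; exists Y.
Qed.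

End ChainMaps.

(* The homotopies need not be homogeneous: the maps they compare are. *)
Definition null_homotopic F i :
    'M[S]_(gfc_rank F i) -> 'M[S]_(gfc_rank F i, gfc_rank F i.+1) -> Prop :=
  match i with
  | 0%N => fun X h => X = h *m gfc_diff F 0
  | i'.+1 => fun X h => exists h', X = h *m gfc_diff F i'.+1 + gfc_diff F i' *m h'
  end.

Lemma chain_map_homotopy F i X : is_graded_free_resolution F ->
  @chain_map F F i X -> exists h, null_homotopic (X - 1%:M) h.
Proof.
move=> resF; elim: i X => [|i IHi] X /=.
  move=> hX; have [k|h hE] := @gfr_lift0 _ resF _ (X - 1%:M); last by exists h.
  by rewrite rowE mulmxBr mulmx1 raddfB; apply/eqP; rewrite subr_eq0; apply/eqP/hX.
case=> Y hY XE; have [h hh] := IHi _ hY.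
(* By the homotopy one degree lower, the part of [X - 1%:M] not accounted for by [h] is killed by
   the differential, hence lifts. *)
have [|h' hE] := @gfr_lift _ resF i _ (X - 1%:M - gfc_diff F i *m h); last first.
  by exists h', h; rewrite hE subrK.
rewrite !mulmxBl XE mul1mx -!mulmxA.
rewrite -{2}[gfc_diff F i]mulmx1 -!mulmxBr.
case: i {IHi} => [|i] in X Y hY XE h hh *; first by rewrite hh subrr mulmx0.
have [h' ->] := hh.
by rewrite addrAC subrr add0r mulmxA gfr_diff_diff ?mul0mx.
Qed.

Local Notation bar A := (map_mx (@mcoeff n K 0%MM) A).

(** A nonzero constant term has degree 0, so it occurs only between equal shifts. *)
Lemma tor_degree_homog F G i j (X : 'M_(gfc_rank F i, gfc_rank G i)) :
    mx_homog (shift F i) (shift G i) X ->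
  tor_degree F i j *m bar X
    = bar X *m tor_degree G i j.
Proof.
move=> homX; rewrite /tor_degree; apply/matrixP => k l.
rewrite mul_diag_mx mul_mx_diag !mxE mulrC.
have [-> // | ne] := eqVneq (gfc_shift k) (gfc_shift l).
by rewrite (mx_homog_mcoeff0 homX ne) !mul0r.
Qed.

(** The composite of chain maps from [F] to [G] and back is homotopic to the identity, so the first
    one is injective on Tor. *)
Lemma tor_dim_le F G i j :
    is_graded_free_resolution F -> is_graded_free_resolution G ->
  (tor_dim F i j <= tor_dim G i j)%N.
Proof.
move=> resF resG.
have [X hX homX] := chain_map_exists resF resG i.
have [Y hY homY] := chain_map_exists resG resF i.
(* The component of the return map one degree higher shows that boundaries go to boundaries. *)
have [Y' Y'E _] := chain_map_step resG resF hY homY.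
have [h hh] := chain_map_homotopy resF (chain_map_comp hX hY).
have degS H H' (W : 'M_(gfc_rank H i, gfc_rank H' i)) l (A : 'M_(l, _)) :
    mx_homog (shift H i) (shift H' i) W ->
  (A <= tor_degree H i j)%MS -> (A *m bar W <= tor_degree H' i j)%MS.
  by move=> homW /submxP[D ->]; rewrite -mulmxA tor_degree_homog // mulmxA submxMl.
rewrite /tor_dim; apply: (rank_quotient_le (P := bar X) (Q := bar Y)).
- rewrite sub_capmx degS ?capmxSr // andbT.
  apply: (submx_trans (submxMr _ (capmxSl _ _))).
  case: i X hX {homX Y hY homY Y' Y'E h hh degS} => [|i] X /=.
    by rewrite submx1.
  case=> W _ XE; apply/sub_kermxP.
  by rewrite -mulmxA /tor_diff -map_mxM XE map_mxM mulmxA mulmx_ker mul0mx.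
- apply: capmxS => //; case: (i) => [|i']; first exact: submx1.
  apply/sub_kermxP; rewrite /tor_diff -map_mxM gfr_diff_diff //.
  exact: map_mx0.
- rewrite sub_capmx degS ?capmxSr // andbT.
  apply: (submx_trans (submxMr _ (capmxSl _ _))).
  by rewrite /tor_diff -map_mxM -Y'E map_mxM submxMl.
rewrite sub_capmx; apply/andP; split; last first.
  rewrite mulmxBr mulmx1 mulmxA; apply: addmx_sub.
    by rewrite !degS ?capmxSr.
  by rewrite eqmx_opp capmxSr.
have -> : bar X *m bar Y - 1%:M = bar (X *m Y - 1%:M).
  by rewrite map_mxB map_mxM map_mx1.
apply: (submx_trans (submxMr _ (capmxSl _ _))).
case: i X Y h hh {hX hY homX homY degS Y' Y'E} => [|i] X Y h /=.
  by move->; rewrite map_mxM mulmxA submxMl.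
case=> h' ->; rewrite map_mxD mulmxDr !map_mxM !mulmxA mulmx_ker.
by rewrite mul0mx addr0 submxMl.
Qed.

(** The value picked by [betti] comes from some resolution; [tor_dim_le] in both directions
    identifies it with that of [F]. *)
Lemma bettiE F i j : is_graded_free_resolution F -> betti I i j = tor_dim F i j.
Proof.
move=> resF.
have : exists b, exists2 G, is_graded_free_resolution G
    & @tor_dim _ _ I G i j = b.
  by exists (tor_dim F i j), F.
move/(ClassicalEpsilon.epsilon_spec (inhabits 0%N)) => -[G resG].
rewrite -/(the _) -/(betti I i j) => <-.
by apply/eqP; rewrite eqn_leq !tor_dim_le.
Qed.

End Comparison.

(** * Free modules and bounds on projective dimension *)

Lemma row_projective (R : nzRingType) q : projective 'rV[R]_q.
Proof.
move=> A B g f g_surj.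
have /fin_all_exists[a aE] k : exists a, g a = f (delta_mx 0 k) by apply: g_surj.
pose h (x : 'rV[R]_q) := \sum_k x 0 k *: a k.
have h_lin : linear h.
  move=> c x y; rewrite /h scaler_sumr -big_split; apply: eq_bigr => k _.
  by rewrite !mxE scalerDl scalerA.
pose hL : {linear 'rV[R]_q -> A} := HB.pack h (GRing.isLinear.Build _ _ _ _ h h_lin).
exists hL => x /=.
rewrite linear_sum [x in RHS]row_sum_delta linear_sum; apply: eq_bigr => k _.
by rewrite !linearZ aE.
Qed.

Lemma proj_dim_leP (R : nzRingType) (M : lmodType R) p :
  proj_dim_le M p -> (proj_dim M <= p)%N.
Proof.
(* The specification of [proj_dim] applies only once a least bound exists; excluded middle makes the
   predicate boolean, so that [ex_minnP] finds one. *)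
move=> hp; pose P q : bool :=
  if ClassicalEpsilon.excluded_middle_informative (proj_dim_le M q)
  then true else false.
have PP q : reflect (proj_dim_le M q) (P q).
  by rewrite /P; case: ClassicalEpsilon.excluded_middle_informative; constructor.
have exP : exists q, P q by exists p; apply/PP.
have : exists q, proj_dim_le M q /\ forall q', proj_dim_le M q' -> (q <= q')%N.
  case: (ex_minnP exP) => q /PP Pq minq; exists q; split=> // q' /PP.
  exact: minq.
by case/(ClassicalEpsilon.epsilon_spec (inhabits 0%N)) => _; apply.
Qed.

Lemma exists_subset_card (T : finType) (A : {set T}) k :
  (k <= #|A|)%N -> exists2 B : {set T}, #|B| = k & B \subset A.
Proof.
rewrite -bin_gt0 -cards_draws => /card_gt0P[B].
by rewrite inE => /andP[sBA /eqP cB]; exists B.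
Qed.

(** * The Taylor complex as a graded free resolution *)

Section TaylorResolution.
Variables (K : fieldType) (n r : nat) (m : 'I_r -> 'X_{1..n}).
Local Notation S := {mpoly K[n]}.
Local Notation lc A := (lcm_family A m).
Implicit Types (A B : {set 'I_r}).

Definition taylor_rank i := #|[set A : {set 'I_r} | #|A| == i]|.

Definition face i (k : 'I_(taylor_rank i)) : {set 'I_r} := enum_val k.

Lemma card_face i (k : 'I_(taylor_rank i)) : #|face k| = i.
Proof. by have := enum_valP k; rewrite inE => /eqP. Qed.

Lemma face_inj i : injective (@face i).
Proof. exact: enum_val_inj. Qed.

Lemma face_surj i A : #|A| = i -> exists k : 'I_(taylor_rank i), face k = A.
Proof.
move=> cA; have iA : A \in [set B : {set 'I_r} | #|B| == i] by rewrite inE cA.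
by exists (enum_rank_in iA A); rewrite /face enum_rankK_in.
Qed.

Definition row_of_fun i (f : {set 'I_r} -> S) : 'rV[S]_(taylor_rank i) :=
  \row_k f (face k).

(** Extension by zero from the faces of size [i] to all subsets, where the calculus of [taylor_bd]
    takes place. *)
Definition fun_of_row i (x : 'rV[S]_(taylor_rank i)) A : S :=
  \sum_(k | face k == A) x 0 k.

Lemma fun_of_row_face i (x : 'rV_(taylor_rank i)) k : fun_of_row x (face k) = x 0 k.
Proof.
rewrite /fun_of_row (bigD1 k) //= big1 ?addr0 // => l /andP[/eqP/face_inj->].
by rewrite eqxx.
Qed.

Lemma fun_of_row0 i (x : 'rV_(taylor_rank i)) A : #|A| <> i -> fun_of_row x A = 0.
Proof. by move=> cA; apply: big1 => k /eqP kA; case: cA; rewrite -kA card_face. Qed.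

Lemma row_of_funK i f A : #|A| = i -> fun_of_row (row_of_fun i f) A = f A.
Proof. by move=> /face_surj[k <-]; rewrite fun_of_row_face mxE. Qed.

Lemma fun_of_rowK i (x : 'rV_(taylor_rank i)) : row_of_fun i (fun_of_row x) = x.
Proof. by apply/rowP => k; rewrite mxE fun_of_row_face. Qed.

Definition taylor_diff i : 'M[S]_(taylor_rank i.+1, taylor_rank i) :=
  \matrix_(k, l) taylor_coef K m (face k) (face l).

Lemma fun_of_row_diff i (x : 'rV_(taylor_rank i.+1)) A :
  fun_of_row (x *m taylor_diff i) A = taylor_bd m (fun_of_row x) A.
Proof.
have [/face_surj[l <-] | /eqP cA] := eqVneq #|A| i; last first.
  rewrite fun_of_row0 // /taylor_bd big1 // => j jA.
  by rewrite fun_of_row0 ?mul0r ?scaler0 // cardsU1 jA => -[].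
rewrite fun_of_row_face mxE /taylor_bd.
under eq_bigr => k _ do rewrite mxE mulr_sumr.
rewrite (exchange_big_dep (fun j => j \notin face l)) /=; last first.
  by move=> k j _ /andP[].
apply: eq_bigr => j jl; rewrite mulr_suml scaler_sumr.
apply: eq_big => k; first by rewrite jl eq_sym.
by move=> /andP[_ /eqP ->]; rewrite scalerAr.
Qed.

Lemma taylor_diff_exact i (x : 'rV_(taylor_rank i.+1)) :
  x *m taylor_diff i = 0 <-> exists y, y *m taylor_diff i.+1 = x.
Proof.
split=> [xd0 | [y <-]]; last first.
  rewrite -[LHS]fun_of_rowK; apply/rowP => k; rewrite !mxE fun_of_row_diff.
  rewrite -[RHS](taylor_bdK m (fun_of_row y) (face k)).
  by apply: eq_bigr => j _; rewrite fun_of_row_diff.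
have [C | g gE] := @taylor_bd_exact _ _ _ m (fun_of_row x).
  by rewrite -fun_of_row_diff xd0 /fun_of_row big1 // => k _; rewrite mxE.
(* Only the values of [g] on faces of size [i.+2] are kept: the boundary at a face of size [i.+1],
   which is nonempty, depends on no others. *)
exists (row_of_fun _ g); rewrite -[LHS]fun_of_rowK -[RHS]fun_of_rowK.
apply/rowP => k; rewrite !mxE fun_of_row_diff -gE -?card_gt0 ?card_face //.
apply: eq_bigr => j jk; rewrite row_of_funK // cardsU1 jk card_face //.
Qed.

Lemma taylor_bd_set0 (f : {set 'I_r} -> S) :
  taylor_bd m f set0 = \sum_i f [set i] * 'X_[m i].
Proof.
apply: eq_big => [i | i _]; first by rewrite inE.
rewrite /bd_sign (_ : [set j in set0 | _] = set0); last by apply/setP => j; rewrite !inE.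
by rewrite cards0 scale1r setU0 lcm_family1 lcm_family0 subm0.
Qed.

Variable I : submodClosed S^o.

Definition taylor_aug (x : 'rV[S]_(taylor_rank 0)) : quotmod I :=
  quot_proj I (fun_of_row x set0).

Lemma taylor_aug_linear : linear taylor_aug.
Proof.
move=> c x y; rewrite /taylor_aug -linearP; congr quot_proj.
rewrite /fun_of_row scaler_sumr -big_split.
by apply: eq_bigr => k _; rewrite !mxE.
Qed.

HB.instance Definition _ :=
  GRing.isLinear.Build _ _ _ _ taylor_aug taylor_aug_linear.

Definition taylor_complex : graded_free_complex I :=
  {| gfc_rank := taylor_rank;
     gfc_shift := fun i (k : 'I_(taylor_rank i)) => mdeg (lc (face k));
     gfc_diff := taylor_diff;
     gfc_aug := taylor_aug |}.

Hypothesis genI : generated_by I m [set: 'I_r].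

Lemma monomial_ideal_homog d (f : S) : f \in I -> pihomog mdeg d f \in I.
Proof.
case/genI => c ->; apply/genI.
exists (fun i => if (mdeg (m i) <= d)%N then pihomog mdeg (d - mdeg (m i)) (c i)
                 else 0).
rewrite raddf_sum; apply: eq_bigr => i _ /=.
by rewrite (@pihomogM _ _ _ (mdeg (m i))) ?dhomogX //; case: ifP; rewrite ?mul0r.
Qed.

(** At the empty face the boundary is a combination of the generators, so the first differential has
    image [I] in the free module of rank one. *)
Lemma taylor_aug_exact x :
  taylor_aug x = 0 <-> exists y, y *m taylor_diff 0 = x.
Proof.
have xE y : y *m taylor_diff 0 = x <->
    \sum_i fun_of_row y [set i] * 'X_[m i] = fun_of_row x set0.
  rewrite -taylor_bd_set0 -fun_of_row_diff; split=> [-> // | yx].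
  rewrite -[LHS]fun_of_rowK -[RHS]fun_of_rowK; apply/rowP => k; rewrite !mxE.
  by have /eqP := card_face k; rewrite cards_eq0 => /eqP ->.
rewrite /taylor_aug -[X in _ = X <-> _](raddf0 (quot_proj I)).
split=> [/quot_proj_eq | [y /xE <-]].
  rewrite subr0 => /genI[c cE]; exists (row_of_fun _ (fun A => \sum_(i in A) c i)).
  apply/xE; rewrite cE; apply: eq_big => [i|i _]; first by rewrite inE.
  by rewrite row_of_funK ?cards1 // big_set1.
apply/quot_proj_eq; rewrite subr0; apply/genI; exists (fun i => fun_of_row y [set i]).
by apply: eq_bigl => i; rewrite inE.
Qed.

Lemma taylor_coef_homog A B : taylor_coef K m A B = 0 \/
  exists2 e, (e + mdeg (lc B) = mdeg (lc A))%N & taylor_coef K m A B \is e.-homog.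
Proof.
have [sBA | nsBA] := boolP (B \subset A); last first.
  left; apply: big1 => i /andP[_ /eqP defA]; case/negP: nsBA.
  by rewrite -defA subsetUr.
right; exists (mdeg (lc A - lc B)); first by rewrite -mdegD submK // lcm_familyS.
by apply: rpred_sum => i _; rewrite rpredZ // dhomogX.
Qed.

Lemma taylor_resolution : is_graded_free_resolution taylor_complex.
Proof.
split=> [i k l | k | ].
- by rewrite mxE; apply: taylor_coef_homog.
- have /eqP := card_face k; rewrite cards_eq0 => /eqP k0.
  exists 1; rewrite /= /taylor_aug.
    by rewrite k0 lcm_family0 mdeg0 dhomog1.
  by rewrite -k0 fun_of_row_face mxE !eqxx.
split=> [y | | i x]; [ | exact: taylor_aug_exact | exact: taylor_diff_exact].
have [f <-] := quot_proj_surj y; exists (row_of_fun _ (fun=> f)).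
by rewrite /= /taylor_aug row_of_funK ?cards0.
Qed.

(** Faces have at most [r] elements, so the Taylor resolution vanishes above degree [r]. *)
Lemma proj_dim_monomial : (proj_dim (quotmod I) <= r)%N.
Proof.
apply: proj_dim_leP.
exists (fun i => 'rV[S]_(taylor_rank i)), (fun i => mulmxr (taylor_diff i)), taylor_aug.
split=> [|i|i ri x]; [by case: taylor_resolution | exact: row_projective |].
apply/rowP => k; have := max_card (mem (face k)).
by rewrite card_face card_ord leqNgt ri.
Qed.

(** * Betti numbers and maximal shifts when lcms grow strictly *)

Section Minimal.
Hypothesis lcm_strict : forall i B, i \notin B -> lc (i |: B) <> lc B.

Lemma taylor_tor_diff0 i : tor_diff taylor_complex i = 0.
Proof.
apply/matrixP => k l; rewrite !mxE raddf_sum big1 //= => j /andP[jl /eqP <-].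
rewrite mcoeffZ mcoeffX; case: eqP => [eq0|]; last by rewrite mulr0.
case: (lcm_strict jl); have /submK <- : (lc (face l) <= lc (j |: face l))%MM.
  by rewrite lcm_familyS ?subsetUr.
by rewrite eq0 add0m.
Qed.

(** With zero differentials, [tor_dim] is the rank of the diagonal matrix [tor_degree], which counts
    the faces of size [i] whose lcm has degree [j]. *)
Lemma betti_monomial i j :
  betti I i j <> 0%N <-> exists2 A : {set 'I_r}, #|A| = i & mdeg (lc A) = j.
Proof.
rewrite (bettiE monomial_ideal_homog _ _ taylor_resolution) /tor_dim taylor_tor_diff0.
rewrite cap0mx mxrank0 subn0.
have /capmx_idPr -> :
    (tor_degree taylor_complex i j <= tor_cycles taylor_complex i)%MS.
  case: i => [|i]; first exact: submx1.
  by apply/sub_kermxP; rewrite taylor_tor_diff0 mulmx0.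
rewrite /tor_degree; split=> [/eqP | [A /face_surj[k <-] kj] /eqP].
  rewrite mxrank_eq0 => /eqP V0.
  have [k kj | none] := pickP (fun k : 'I_(taylor_rank i) => mdeg (lc (face k)) == j).
    by exists (face k); [exact: card_face | exact/eqP].
  by case: V0; apply/matrixP => k l; rewrite !mxE /= none mul0rn.
rewrite mxrank_eq0 => /eqP/matrixP/(_ k k)/eqP.
by rewrite !mxE /= kj !eqxx oner_eq0.
Qed.

(** The bound on [i] provides a subset of size [i], so the maximum exists and [max_shift] meets its
    specification. *)
Lemma max_shift_monomial i : (i <= r)%N ->
  (exists2 A : {set 'I_r}, #|A| = i & mdeg (lc A) = max_shift I i) /\
  forall A : {set 'I_r}, #|A| = i -> (mdeg (lc A) <= max_shift I i)%N.
Proof.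
move=> ir; have [|A0 /eqP cA0 _] := @exists_subset_card _ [set: 'I_r] i.
  by rewrite cardsT card_ord.
have : exists t, betti I i t <> 0%N /\ forall j, betti I i j <> 0%N -> (j <= t)%N.
  have [A /eqP cA maxA] :=
    @arg_maxnP _ A0 (fun A => #|A| == i) (fun A => mdeg (lc A)) cA0.
  exists (mdeg (lc A)); split; first by apply/betti_monomial; exists A.
  by move=> j /betti_monomial[B cB <-]; apply: maxA; apply/eqP.
move/(ClassicalEpsilon.epsilon_spec (inhabits 0%N)) => -[/betti_monomial hA maxA].
by split=> // A cA; apply: maxA; apply/betti_monomial; exists A.
Qed.

End Minimal.

End TaylorResolution.

(** * Subadditivity of the maximal shifts *)

Lemma lcm_family_strict (K : fieldType) (n r : nat) (m : 'I_r -> 'X_{1..n}) :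
    (forall (i : 'I_r) (c : K),
      'X_[lcm_family [set: 'I_r] m - lcm_family [set~ i] m] <> c%:MP_[n]) ->
  forall (i : 'I_r) (B : {set 'I_r}), i \notin B ->
  lcm_family (i |: B) m <> lcm_family B m.
Proof.
(* If adjoining [i] left the lcm of [B] unchanged, [m i] would divide the lcm of the other
   generators, and the quotient in the hypothesis would be 1. *)
move=> hlcm i B iB eqB; apply: (hlcm i 1); rewrite mpolyC1 -(mpolyX0 n K).
congr 'X_[_]; apply/mnmP => v; rewrite mnmBE mnm0E; apply/eqP; rewrite subn_eq0.
move: v; apply/mnm_lepP/lcm_familyP => j _; have [-> | ji] := eqVneq j i.
  apply: lepm_trans (lem_lcm_family _ (setU11 i B)) _; rewrite eqB.
  apply: lcm_familyS; apply/subsetP => l lB; rewrite !inE.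
  by apply: contraNneq iB => <-.
by apply: lem_lcm_family; rewrite !inE.
Qed.

Theorem corollary4p2 (K : fieldType) (n r : nat)
    (I : submodClosed {mpoly K[n]}^o) (m : 'I_r -> 'X_{1..n})
    (hG : minimal_monomial_generators I m)
    (hlcm : forall (i : 'I_r) (c : K),
      'X_[lcm_family [set: 'I_r] m - lcm_family [set~ i] m] <> c%:MP_[n])
    (a b : nat) (hab : (a + b <= proj_dim (quotmod I))%N) :
  (max_shift I (a + b) <= max_shift I a + max_shift I b)%N.
Proof.
have [genI _] := hG; have strict := lcm_family_strict hlcm.
have abr := leq_trans hab (proj_dim_monomial genI).
(* A face [A] attaining the shift in degree [a + b] is cut into faces of sizes [a] and [b], whose
   lcm degrees the two maximal shifts bound. *)
have [[A cA <-] _] := max_shift_monomial genI strict abr.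
have [|B cB sBA] := @exists_subset_card _ A a; first by rewrite cA leq_addr.
have cC : #|A :\: B| = b by rewrite cardsDS // cA cB addKn.
rewrite -(setID A B) (setIidPr sBA).
have [_ maxB] := max_shift_monomial genI strict (leq_trans (leq_addr b a) abr).
have [_ maxC] := max_shift_monomial genI strict (leq_trans (leq_addl a b) abr).
exact: leq_trans (mdeg_lcm_familyU _ _ _) (leq_add (maxB _ cB) (maxC _ cC)).
Qed.
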